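(* Let $r_0, r_1, r_2$ be positive integers with $r_0<r_1<r_2$, and let $P\in NM(r_0,r_1,r_2,r_0)$, i.e. $P$ is a normalized matching poset of rank $3$ with rank numbers $(r_0,r_1,r_2,r_0)$. If there is an integer $k$ such that $kr_0\le r_1\le k(r_0+1)$, then $P$ is nested.
   Context: All posets are finite. A chain in a poset is a (nonempty) totally ordered subset; $|C|$ denotes the number of elements of a chain $C$. Chains are not required to be saturated (they may skip ranks). A chain decomposition of a poset $P$ is a collection $\mathcal{C}$ of pairwise disjoint chains of $P$ whose union is $P$. A graded poset is a poset in which all maximal chains have the same length. Its rank function $r:P\to\mathbb{N}$ is defined by $r(x)=i$ if there are exactly $i$ elements $y<x$ in a maximal chain containing $x$. The rank of $P$ is $\max_{x\in P} r(x)$. The $i$th level is $L_i=\{x\in P : r(x)=i\}$, and $r_i=|L_i|$. The rank numbers of a graded poset of rank $n$ are the sequence $(r_0,r_1,\ldots,r_n)$. For levels $L_i, L_j$ and $S\subseteq L_i$, put $\Gamma_j(S)=\{x\in L_j : x\le y \text{ or } y\le x \text{ for some } y\in S\}$. The graded poset $P$ is a normalized matching poset if for all levels $L_i,L_j$ and all $S\subseteq L_i$, $$\frac{|S|}{r_i}\le \frac{|\Gamma_j(S)|}{r_j}.$$ $NM(r_0,r_1,\ldots,r_n)$ denotes the collection of all normalized matching posets of rank $n$ with rank numbers $(r_0,r_1,\ldots,r_n)$. A chain decomposition $\mathcal{C}$ of a graded poset $P$ is a nested chain decomposition (a nesting) if for any chains $C_i,C_j\in\mathcal{C}$, $|C_i|\le|C_j|$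 implies $\{r(x): x\in C_i\}\subseteq\{r(x): x\in C_j\}$, where $r(x)$ is the rank of $x$ in $P$. The poset $P$ is nested if it has a nesting. *)

(* Defs.v *)
From HB Require Import structures.
From mathcomp Require Import all_boot all_order all_algebra.

Set Implicit Arguments.
Unset Strict Implicit.
Unset Printing Implicit Defensive.

Import Order.TTheory GRing.Theory Num.Theory.

Definition is_chain (d : Order.disp_t) (T : finPOrderType d) (C : {set T}) : bool :=
  (C != set0) && [forall x in C, forall y in C, (x >=< y)%O].

Definition max_chain (d : Order.disp_t) (T : finPOrderType d) (C : {set T}) : bool :=
  maxset (@is_chain d T) C.

Definition graded (d : Order.disp_t) (T : finPOrderType d) : Prop :=
  forall C D : {set T}, max_chain C -> max_chain D -> #|C| = #|D|.

(* A maximal chain through x is picked; when T is graded the value does not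
   depend on it.  Every x lies in some maximal chain, so the default is unused. *)
Definition rk (d : Order.disp_t) (T : finPOrderType d) (x : T) : nat :=
  if [pick C : {set T} | max_chain C && (x \in C)] is Some C
  then #|[set y in C | (y < x)%O]| else 0.

Definition poset_rank (d : Order.disp_t) (T : finPOrderType d) : nat :=
  \max_(x : T) rk x.

Definition level (d : Order.disp_t) (T : finPOrderType d) (i : nat) : {set T} :=
  [set x : T | rk x == i].

Definition rank_numbers (d : Order.disp_t) (T : finPOrderType d) : seq nat :=
  [seq #|level T i| | i <- iota 0 (poset_rank T).+1].

Definition Gamma (d : Order.disp_t) (T : finPOrderType d) (j : nat) (S : {set T})
    : {set T} :=
  [set x in level T j | [exists y in S, (x <= y)%O || (y <= x)%O]].

Definition normalized_matching (d : Order.disp_t) (T : finPOrderType d) : Prop :=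
  forall (i j : nat) (S : {set T}),
    i <= poset_rank T -> j <= poset_rank T -> S \subset level T i ->
    (#|S|%:R / #|level T i|%:R <= #|Gamma j S|%:R / #|level T j|%:R :> rat)%R.

(* Membership of T in NM(rs); the rank is the length of rs minus one. *)
Definition in_NM (d : Order.disp_t) (rs : seq nat) (T : finPOrderType d) : Prop :=
  [/\ graded T, normalized_matching T & rank_numbers T = rs].

Definition chain_decomposition (d : Order.disp_t) (T : finPOrderType d)
    (D : {set {set T}}) : Prop :=
  partition D [set: T] /\ (forall C : {set T}, C \in D -> is_chain C).

Definition nesting (d : Order.disp_t) (T : finPOrderType d) (D : {set {set T}}) : Prop :=
  chain_decomposition D /\
  forall A B : {set T}, A \in D -> B \in D -> #|A| <= #|B| ->
    {subset [seq rk x | x in A] <= [seq rk x | x in B]}.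

Definition nested (d : Order.disp_t) (T : finPOrderType d) : Prop :=
  exists D : {set {set T}}, nesting D.

(* Main.v *)
Require Import Defs.
From mathcomp Require Import all_boot all_order all_algebra.
From mathcomp Require Import zify.

(* Write a = r_0 = r_3, m = r_1, n = r_2 and m = k a + e, so that e <= k.  By
   Hall's theorem and normalized matching between the levels 1, 2, 3, level 1 can
   be matched injectively into level 2 by some f so that, apart from e of them,
   the elements of f(L_1) are assigned to elements of L_3 above them, k to each.
   Call x in L_0 and z in L_3 adjacent if some l > x in L_1 has f l assigned to z.
   A set S of L_0 with neighbourhood N in L_3 satisfies
   m |S| / a <= |Gamma_1 S| <= k |N| + e, and e <= k forces |S| <= |N|; so Hall's
   theorem gives a perfect matching of L_0 with L_3, that is, a disjoint chains of
   size 4, each using a pair l < f l.  The other pairs l < f l and the singletons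
   of L_2 \ f(L_1) complete the nesting. *)

Set Implicit Arguments.
Unset Strict Implicit.
Unset Printing Implicit Defensive.

Import Order.TTheory GRing.Theory Num.Theory.

(** * Hall's marriage theorem *)

Definition nbhd (T U : finType) (e : T -> U -> bool) (S : {set T}) : {set U} :=
  [set u | [exists x in S, e x u]].

Lemma nbhdP (T U : finType) (e : T -> U -> bool) (S : {set T}) (u : U) :
  reflect (exists2 x, x \in S & e x u) (u \in nbhd e S).
Proof. by rewrite inE; apply: exists_inP. Qed.

(** Induction on the size of [A]. If a nonempty proper subset [S] is tight, match [S] and then
    [A :\: S] away from the neighbours of [S]; otherwise match one element arbitrarily and delete
    its partner. [u0] is the value of [f] when [A] is empty. *)
Lemma hall (T U : finType) (u0 : U) (e : T -> U -> bool) (A : {set T}) :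
  (forall S : {set T}, S \subset A -> #|S| <= #|nbhd e S|) ->
  exists f : T -> U, {in A &, injective f} /\ {in A, forall x, e x (f x)}.
Proof.
have [n] := ubnP #|A|; elim: n => // n IHn in e A *; rewrite ltnS => leAn hallA.
case: (set_0Vmem A) => [->|[x xA]].
  by exists (fun=> u0); split=> [x y|x]; rewrite inE.
have [/existsP[S /and3P[S0 SpA /eqP tightS]]|/existsPn loose] := boolP
    [exists S : {set T}, [&& S != set0, S \proper A & #|nbhd e S| == #|S|]].
  have sSA := proper_sub SpA.
  have [f [injf ef]] : exists f : T -> U,
      {in S &, injective f} /\ {in S, forall x, e x (f x)}.
    apply: IHn => [|R sRS]; first exact: leq_trans (proper_card SpA) leAn.
    exact: hallA (subset_trans sRS sSA).
  have [|R sR|g [injg eg]] :=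
      IHn (fun x u => e x u && (u \notin nbhd e S)) (A :\: S).
  - apply: leq_trans leAn; rewrite cardsD (setIidPr sSA).
    by rewrite ltn_subrL !card_gt0 S0; apply/set0Pn; exists x.
  - have dRS : [disjoint R & S].
      rewrite disjoints_subset; apply/subsetP=> y /(subsetP sR).
      by rewrite !inE => /andP[].
    (* Hall's condition for [R :|: S], minus the tight equality for [S], is the condition for [R] in
       the restricted relation. *)
    have := hallA (R :|: S).
    rewrite subUset sSA (subset_trans sR (subsetDl _ _)) => /(_ isT).
    have -> : #|R :|: S| = #|R| + #|S| by rewrite cardsU disjoint_setI0 ?cards0 ?subn0.
    rewrite -tightS => le1; rewrite -(leq_add2r #|nbhd e S|) (leq_trans le1) //.
    set N := nbhd _ R; apply: leq_trans (_ : #|N :|: nbhd e S| <= _); last first.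
      by rewrite cardsU leq_subr.
    apply: subset_leq_card; apply/subsetP=> u /nbhdP[y].
    rewrite in_setU => yRS eyu; rewrite in_setU.
    have [uS|uS] := boolP (u \in nbhd e S); first by rewrite orbT.
    case/orP: yRS => [yR|yS]; first by rewrite orbF; apply/nbhdP; exists y; rewrite ?eyu.
    by case/negP: uS; apply/nbhdP; exists y.
  have fS y : y \in S -> f y \in nbhd e S.
    by move=> yS; apply/nbhdP; exists y => //; apply: ef.
  have gS y : y \in A -> y \notin S -> g y \notin nbhd e S.
    by move=> yA yS; have := eg y; rewrite in_setD yS yA => /(_ isT)/andP[].
  exists (fun y => if y \in S then f y else g y); split=> [y z yA zA|y yA].
    case: ifPn => yS; case: ifPn => zS eq_yz.
    - exact: injf.
    - by have := gS z zA zS; rewrite -eq_yz fS.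
    - by have := gS y yA yS; rewrite eq_yz fS.
    - by apply: injg; rewrite ?inE ?yS ?zS.
  case: ifPn => yS; first exact: ef.
  by have := eg y; rewrite in_setD yS yA => /(_ isT)/andP[].
have /card_gt0P[u /nbhdP[z /set1P-> {z}exu]] : 0 < #|nbhd e [set x]|.
  by rewrite -(cards1 x) hallA ?sub1set.
have [|R sR|g [injg eg]] := IHn (fun y v => e y v && (v != u)) (A :\ x).
- by rewrite (cardsD1 x A) xA in leAn.
- case: (set_0Vmem R) => [->|[y yR]]; first by rewrite cards0.
  have sRA : R \proper A.
    apply: (sub_proper_trans sR); exact: properD1.
  have := loose R; rewrite sRA /= => /nandP[/negP[]|neqR].
    by apply/set0Pn; exists y.
  (* No tight proper subset: the surplus of one pays for the deleted [u]. *)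
  have ltR : #|R| < #|nbhd e R|.
    by rewrite ltn_neqAle eq_sym neqR hallA ?proper_sub.
  rewrite -ltnS (leq_trans ltR) // (cardsD1 u) -add1n leq_add ?leq_b1 //.
  apply/subset_leq_card/subsetP=> v /setD1P[nvu /nbhdP[w wR ewv]].
  by apply/nbhdP; exists w; rewrite ?ewv.
have gu z : z \in A -> z != x -> g z != u.
  by move=> zA zx; have := eg z; rewrite in_setD1 zx zA => /(_ isT)/andP[].
exists (fun z => if z == x then u else g z); split=> [z w zA wA|z zA].
  case: eqP => [->|/eqP zx]; case: eqP => [->|/eqP wx] // eq_zw.
  - by have := gu w wA wx; rewrite eq_zw eqxx.
  - by have := gu z zA zx; rewrite eq_zw eqxx.
  - by apply: injg; rewrite ?inE ?zx ?wx.
case: eqP => [->//|/eqP zx].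
by have := eg z; rewrite in_setD1 zx zA => /(_ isT)/andP[].
Qed.

(** * Disjoint paths from counting conditions *)

(** Normalized matching with the denominators cleared, so that it lives in [nat]. *)
Definition matching_ratio (T : finType) (r : rel T) (A B : {set T}) : Prop :=
  forall S : {set T}, S \subset A -> #|S| * #|B| <= #|B :&: nbhd r S| * #|A|.

Lemma card_set_sum (T U : finType) (S : {set T + U}) :
  #|S| = #|[set x | inl x \in S]| + #|[set y | inr y \in S]|.
Proof. by rewrite -sum1_card big_sumType -!sum1dep_card. Qed.

Lemma card_slices (T U : finType) (S : {set T * U}) (Z : {set T}) :
  {in S, forall p, p.1 \in Z} -> #|S| <= #|U| * #|Z|.
Proof.
move=> SZ; rewrite mulnC -cardsT -cardsX; apply/subset_leq_card/subsetP=> p pS.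
by rewrite !inE SZ.
Qed.

Section Linkage.

Variables (T : finType) (r : rel T) (M N Z : {set T}) (k e : nat).

(* Perfect matchings of [link] encode disjoint paths from k copies of each z in Z
   and e dummy sources, through N, onto M: if [inl v] (entering v) is matched to a
   source then [inr v] (leaving v) must go to M, whereas a v off every path has
   [inr v] matched to [inl v]. *)
Definition link (x : (T * 'I_k + 'I_e) + T) (y : T + T) : bool :=
  match x, y with
  | inl (inl (z, _)), inl v => (v \in N) && r z v
  | inl (inr _), inl v => v \in N
  | inr v, inl v' => v == v'
  | inr v, inr l => (l \in M) && r v l
  | _, _ => false
  end.

Definition sources : {set (T * 'I_k + 'I_e) + T} :=
  [set x | match x with
           | inl (inl (z, _)) => z \in Z
           | inl (inr _) => true
           | inr v => v \in N
           end].

(** Split [S] into copies [X], dummies [D] and exits [V]; let [W] and [G] be the neighbours in [N]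
    and [M], m = |M|, n = |N|. In both cases below n (|X| + |D|) <= m |W|, |V| <= |W| and m |V| <= n
    |G|, so the claim follows from (n - m)(|W| - |V|) >= 0. *)
Lemma link_hall (S : {set (T * 'I_k + 'I_e) + T}) :
  matching_ratio r N M -> matching_ratio r Z N ->
  #|M| = k * #|Z| + e -> #|M| <= #|N| -> 0 < #|M| ->
  S \subset sources -> #|S| <= #|nbhd link S|.
Proof.
move=> NM_NM NM_ZN cardM leMN M0 sS.
rewrite (card_set_sum S) (card_set_sum (nbhd link S)) (card_set_sum [set x | inl x \in S]).
set D := [set y : 'I_e | _]; set X := [set x : T * 'I_k | _].
set V := [set y | inr y \in S]; set W := [set x | _ \in nbhd _ _]; set G := [set y | _ \in nbhd _ _].
have sVN : V \subset N.
  by apply/subsetP=> v; rewrite inE => /(subsetP sS); rewrite inE.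
have sVW : V \subset W.
  by apply/subsetP=> v; rewrite !inE => vS; apply/exists_inP; exists (inr v) => /=.
have leVW := subset_leq_card sVW.
have leVG : #|V| * #|M| <= #|G| * #|N|.
  apply: leq_trans (NM_NM V sVN) _; rewrite leq_mul2r; apply/orP; right.
  apply/subset_leq_card/subsetP=> l; rewrite in_setI => /andP[lM /nbhdP[v]].
  by rewrite !inE => vS rvl; apply/exists_inP; exists (inr v) => //=; rewrite lM.
case: (set_0Vmem D) => [->|[j jD]].
  rewrite cards0 addn0.
  set Q := fst @: X.
  have sQZ : Q \subset Z.
    apply/subsetP=> _ /imsetP[[z i] + ->]; rewrite !inE.
    by move=> /(subsetP sS); rewrite inE.
  have leXQ : #|X| <= k * #|Q|.
    by rewrite -[k in k * _]card_ord; apply: card_slices => p; apply: imset_f.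
  have leQW : #|Q| * #|N| <= #|W| * #|Z|.
    apply: leq_trans (NM_ZN Q sQZ) _; rewrite leq_mul2r; apply/orP; right.
    apply/subset_leq_card/subsetP=> v; rewrite in_setI => /andP[vN /nbhdP[z]].
    case/imsetP=> [[z' i]] + -> /=; rewrite !inE => zS rzv.
    by apply/exists_inP; exists (inl (inl (z', i))) => //=; rewrite vN.
  rewrite -(leq_pmul2r (leq_trans M0 leMN)); nia.
(* A single dummy is adjacent to every entry of [N]. *)
have sNW : N \subset W.
  apply/subsetP=> v vN; rewrite !inE; apply/exists_inP; exists (inl (inr j)) => //.
  by move: jD; rewrite !inE.
have leNW := subset_leq_card sNW.
have leXZ : #|X| <= k * #|Z|.
  rewrite -[k in k * _]card_ord; apply: card_slices => [[z i]]; rewrite !inE.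
  by move=> /(subsetP sS); rewrite inE.
have leDe : #|D| <= e by rewrite -[e in _ <= e]card_ord max_card.
have leVN := subset_leq_card sVN.
rewrite -(leq_pmul2r (leq_trans M0 leMN)); nia.
Qed.

(** Both sides of [link] have |N| + |M| vertices, so a matching is onto and each [l] in [M] can be
    traced back to its vertex [f l] of [N] and the source [q l] of its path. *)
Lemma linkage :
  matching_ratio r N M -> matching_ratio r Z N ->
  #|M| = k * #|Z| + e -> #|M| <= #|N| -> 0 < #|M| ->
  exists (f : T -> T) (q : T -> T * 'I_k + 'I_e),
    [/\ {in M, forall l, f l \in N /\ r (f l) l}, {in M &, injective f},
        {in M &, injective q}
      & {in M, forall l z i, q l = inl (z, i) -> z \in Z /\ r z (f l)}].
Proof.
move=> NM_NM NM_ZN cardM leMN M0.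
have /card_gt0P[l0 l0M] := M0.
have [F [injF linkF]] := hall (inl l0)
  (fun S => @link_hall S NM_NM NM_ZN cardM leMN M0).
pose R := [set y : T + T | match y with inl v => v \in N | inr l => l \in M end].
have cardR : #|R| = #|N| + #|M|.
  by rewrite card_set_sum; congr (_ + _); apply: eq_card => x; rewrite !inE.
have cardA : #|sources| = #|N| + #|M|.
  rewrite (card_set_sum sources) (card_set_sum [set x | inl x \in sources]) addnC.
  congr (_ + _); first by apply: eq_card => x; rewrite !inE.
  rewrite cardM; congr (_ + _).
    rewrite -[k in k * _]card_ord mulnC -cardsT -cardsX; apply: eq_card => [[z i]].
    by rewrite !inE andbT.
  by rewrite -[e in _ = e]card_ord -cardsT; apply: eq_card => i; rewrite !inE.
have imF : F @: sources = R.
  apply/eqP; rewrite eqEcard card_in_imset // cardA cardR leqnn andbT.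
  apply/subsetP=> _ /imsetP[x xA ->]; have := linkF x xA; move: xA; rewrite !inE.
  case: x (F x) => [[[z i]|j]|v] [v'|l] //=; try by move=> _ /andP[].
  by move=> vN /eqP<-.
have preim l : l \in M -> exists p : T * (T * 'I_k + 'I_e),
    [&& p.1 \in N, F (inr p.1) == inr l, inl p.2 \in sources & F (inl p.2) == inl p.1].
  move=> lM; have : inr l \in R by rewrite inE.
  rewrite -imF => /imsetP[[x|v] xA eqF].
    by have := linkF _ xA; rewrite -eqF; case: (x) => [[]|].
  have vN : v \in N by move: xA; rewrite inE.
  have : inl v \in R by rewrite inE.
  rewrite -imF => /imsetP[[x|v'] yA eqF'].
    by exists (v, x); rewrite /= vN -eqF -eqF' !eqxx yA.
  (* An exit can only be matched to the entry of the same vertex, but the exit of [v] is already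
     matched to [l]. *)
  have := linkF _ yA; rewrite -eqF' /= => /eqP eqv.
  by rewrite eqv -eqF in eqF'.
have [p0 _] := preim l0 l0M.
have /fin_all_exists[p pP] l : exists p : T * (T * 'I_k + 'I_e), l \in M ->
    [&& p.1 \in N, F (inr p.1) == inr l, inl p.2 \in sources & F (inl p.2) == inl p.1].
  by case: (boolP (l \in M)) => [/preim[p pP]|_]; [exists p | exists p0].
have pE l : l \in M -> [/\ (p l).1 \in N, F (inr (p l).1) = inr l,
    inl (p l).2 \in sources & F (inl (p l).2) = inl (p l).1].
  by move/pP=> /and4P[? /eqP ? ? /eqP ?].
exists (fun l => (p l).1), (fun l => (p l).2); split.
- move=> l /pE[vN Fv _ _]; split=> //.
  have := linkF (inr (p l).1); rewrite inE => /(_ vN).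
  by rewrite Fv /= => /andP[].
- move=> l l' /pE[_ Fv _ _] /pE[_ Fv' _ _] eqp.
  by move: Fv; rewrite eqp Fv' => -[].
- move=> l l' /pE[_ Fv _ Fx] /pE[_ Fv' _ Fx'] eqp.
  by move: Fx Fv; rewrite eqp Fx' => -[<-]; rewrite Fv' => -[].
- move=> l /pE[vN _ xA Fx] z i eqp; have := linkF _ xA; rewrite Fx eqp /=.
  by move: xA; rewrite eqp inE => zZ /andP[].
Qed.

End Linkage.

Lemma disjoint_paths (T : finType) (r : rel T) (A M N Z : {set T}) (k e : nat) :
  matching_ratio r A M -> matching_ratio r N M -> matching_ratio r Z N ->
  #|A| = #|Z| -> #|M| = k * #|Z| + e -> e <= k -> #|M| <= #|N| -> 0 < #|M| ->
  exists f p s : T -> T,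
    [/\ {in M, forall l, f l \in N /\ r (f l) l}, {in M &, injective f},
        {in A, forall x, [/\ p x \in M, r x (p x), s x \in Z & r (s x) (f (p x))]},
        {in A &, injective p} & {in A &, injective s}].
Proof.
move=> NM_AM NM_NM NM_ZN cardA cardM leek leMN M0.
have [f [q [fN injf injq qZ]]] := linkage NM_NM NM_ZN cardM leMN M0.
pose adj x z := [exists l in M, r x l && [exists i, q l == inl (z, i)]].
have /card_gt0P[l0 _] := M0.
have hallA (S : {set T}) : S \subset A -> #|S| <= #|nbhd adj S|.
  move=> sSA; have leSA := subset_leq_card sSA.
  have := NM_AM S sSA; set G := M :&: nbhd r S.
  have sGM : G \subset M by apply: subsetIl.
  (* The injection [q] sends [G] to dummies, at most [e], and to copies of neighbours of [S], at
     most [k] for each. *)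
  have : #|G| <= k * #|nbhd adj S| + e.
    rewrite -(card_in_imset (sub_in2 (subsetP sGM) injq)) card_set_sum leq_add //.
      rewrite -[k in k * _]card_ord; apply: card_slices => [[z i]].
      rewrite !inE /= => /imsetP[l + eqq]; rewrite in_setI => /andP[lM /nbhdP[x xS rxl]].
      apply/exists_inP; exists x => //; apply/exists_inP; exists l => //.
      by rewrite rxl; apply/existsP; exists i; rewrite -eqq.
    by rewrite -[e in _ <= e]card_ord max_card.
  rewrite cardM -cardA in M0 * => leG leS; rewrite leqNgt; apply/negP=> ltNS.
  have A0 : 0 < #|A| by apply: leq_trans leSA; apply: leq_ltn_trans ltNS.
  (* With B the neighbourhood of [S] and a = |A|, this reads (|B| + 1)(k a + e) <= (k |B| + e) a, so
     k a + e (|B| + 1) <= e a <= k a. Hence e = 0 and k a = 0, against 0 < |M|. *)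
  have := leq_trans (leq_mul ltNS (leqnn _)) (leq_trans leS (leq_mul leG (leqnn _))).
  have : e * #|A| <= k * #|A| by rewrite leq_mul2r leek orbT.
  move: (nbhd adj S) M0 => B; nia.
have [s [injs adjs]] := hall l0 hallA.
have /fin_all_exists[p pP] x : exists l, x \in A ->
    [&& l \in M, r x l & [exists i, q l == inl (s x, i)]].
  case: (boolP (x \in A)) => [/adjs/exists_inP[l lM adjl]|_]; last by exists l0.
  by exists l; rewrite lM.
have pE x : x \in A -> [/\ p x \in M, r x (p x) & exists i, q (p x) = inl (s x, i)].
  by move=> /pP/and3P[? ? /existsP[i /eqP ?]]; split=> //; exists i.
exists f, p, s; split=> // [x /pE[pM rxp [i eqq]]|x y xA yA eqp].
  by have [sZ rsf] := qZ _ pM _ _ eqq; split.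
(* The source of [p x] determines [s x], so [p] inherits injectivity from [s]. *)
have [_ _ [i eqx]] := pE x xA; have [_ _ [j eqy]] := pE y yA.
by apply: injs => //; move: eqx; rewrite eqp eqy => -[].
Qed.

(** * Rank and normalized matching in a graded poset *)

Section Rank.

Variables (d : Order.disp_t) (P : finPOrderType d).
Hypothesis grP : graded P.

Lemma is_chainP (C : {set P}) :
  reflect (C != set0 /\ {in C &, forall x y, (x >=< y)%O}) (is_chain C).
Proof.
apply: (iffP andP) => -[C0].
  by move=> /forall_inP cC; split=> // x y /cC/forall_inP; apply.
by move=> cC; split=> //; apply/forall_inP => x xC; apply/forall_inP => y; apply: cC.
Qed.

(** The part of [C] below [x] and the part of [D] from [x] upwards form a chain; a maximal chain
    containing it has the size of [D]. By symmetry the rank does not depend on the maximal chain. *)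
Lemma chain_below_le (x : P) (C D : {set P}) :
  max_chain C -> max_chain D -> x \in C -> x \in D ->
  #|[set y in C | (y < x)%O]| <= #|[set y in D | (y < x)%O]|.
Proof.
move=> mC mD xC xD.
have /maxsetp/is_chainP[_ cC] := mC; have /maxsetp/is_chainP[_ cD] := mD.
set Cx := [set y in C | _]; set Dx := [set y in D | (y < x)%O].
pose Ux := D :\: Dx.
have UxE y : (y \in Ux) = (y \in D) && (x <= y)%O.
  rewrite !inE; case: (boolP (y \in D)) => yD; rewrite ?andbF ?andbT //=.
  by have /comparable_leNgt -> := cD x y xD yD.
have dCU : [disjoint Cx & Ux].
  rewrite disjoints_subset; apply/subsetP=> y; rewrite in_setC UxE !inE.
  by move=> /andP[_ /lt_geF ->]; rewrite andbF.
have chE : is_chain (Cx :|: Ux).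
  apply/is_chainP; split; first by apply/set0Pn; exists x; rewrite in_setU UxE xD lexx orbT.
  have lt_CU y z : y \in Cx -> z \in Ux -> (y < z)%O.
    by rewrite UxE inE => /andP[_ yx] /andP[_]; apply: lt_le_trans.
  move=> y z; rewrite !in_setU => /orP[yC|yU] /orP[zC|zU].
  - by move: yC zC; rewrite !inE => /andP[yC _] /andP[zC _]; apply: cC.
  - exact/lt_comparable/lt_CU.
  - exact/gt_comparable/lt_CU.
  - by move: yU zU; rewrite !UxE => /andP[yC _] /andP[zC _]; apply: cD.
have [E mE sE] := maxset_exists chE.
have := subset_leq_card sE; rewrite (grP mE mD) cardsU disjoint_setI0 // cards0 subn0.
rewrite -(cardsID Dx D) -/Ux leq_add2r (setIidPr _) //.
by apply/subsetP=> y /setIdP[].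
Qed.

Lemma rkE (x : P) (C : {set P}) :
  max_chain C -> x \in C -> rk x = #|[set y in C | (y < x)%O]|.
Proof.
move=> mC xC; rewrite /rk; case: pickP => [D /andP[mD xD]|/(_ C)]; last by rewrite mC xC.
by apply/eqP; rewrite eqn_leq !chain_below_le.
Qed.

Lemma rk_lt (x y : P) : (x < y)%O -> rk x < rk y.
Proof.
move=> ltxy; have chxy : is_chain [set x; y].
  apply/is_chainP; split; first by apply/set0Pn; exists x; rewrite !inE eqxx.
  move=> u v; rewrite !inE => /orP[]/eqP-> /orP[]/eqP->; rewrite ?comparablexx //.
    exact: lt_comparable.
  exact: gt_comparable.
have [C mC /subsetP sC] := maxset_exists chxy.
have xC : x \in C by rewrite sC ?set21.
have yC : y \in C by rewrite sC ?set22.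
rewrite (rkE mC xC) (rkE mC yC); apply/proper_card/properP; split.
  by apply/subsetP=> z; rewrite !inE => /andP[-> /lt_trans]; apply.
by exists x; rewrite !inE ?xC ?ltxy ?ltxx.
Qed.

Lemma comparable_rk_lt (x y : P) : (x >=< y)%O -> rk x < rk y -> (x < y)%O.
Proof.
case/comparable_ltgtP=> // [/rk_lt ltyx|->]; last by rewrite ltnn.
by move/(ltn_trans ltyx); rewrite ltnn.
Qed.

End Rank.

Lemma normalized_matching_ratio (d : Order.disp_t) (P : finPOrderType d) (i j : nat) :
  normalized_matching P -> i <= poset_rank P -> j <= poset_rank P ->
  0 < #|level P i| -> 0 < #|level P j| ->
  matching_ratio (fun x y : P => (x >=< y)%O) (level P i) (level P j).
Proof.
move=> nmP lei lej i0 j0 S sS; have := nmP i j S lei lej sS.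
rewrite ler_pdivrMr ?ltr0n // mulrAC ler_pdivlMr ?ltr0n // -!natrM ler_nat.
move/leq_trans; apply; rewrite leq_mul2r; apply/orP; right.
apply/subset_leq_card/subsetP=> y; rewrite !inE => /andP[-> /exists_inP[x xS cxy]].
by apply/exists_inP; exists x; rewrite // comparable_sym.
Qed.

(** * The nesting, as the fibres of [hub] *)

Section Nesting.

Variables (d : Order.disp_t) (P : finPOrderType d).
Hypothesis grP : graded P.
Hypothesis rank3 : poset_rank P = 3.

Variables f p s : P -> P.
Hypothesis fP : {in level P 1, forall l, f l \in level P 2 /\ (f l >=< l)%O}.
Hypothesis injf : {in level P 1 &, injective f}.
Hypothesis psP : {in level P 0, forall x,
  [/\ p x \in level P 1, (x >=< p x)%O, s x \in level P 3 & (s x >=< f (p x))%O]}.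
Hypothesis injp : {in level P 0 &, injective p}.
Hypothesis injs : {in level P 0 &, injective s}.
Hypothesis card03 : #|level P 0| = #|level P 3|.

Lemma s_onto (z : P) : rk z = 3 -> exists2 x, rk x = 0 & s x = z.
Proof.
move=> rkz; have : z \in s @: level P 0.
  have /eqP-> : s @: level P 0 == level P 3; last by rewrite inE rkz.
  rewrite eqEcard card_in_imset // card03 leqnn andbT.
  by apply/subsetP=> _ /imsetP[x /psP[_ _ sx _] ->].
by case/imsetP=> x; rewrite inE => /eqP rkx ->; exists x.
Qed.

Definition s_inv (z : P) : P := odflt z [pick x | (rk x == 0) && (s x == z)].

Lemma s_invP (z : P) : rk z = 3 -> rk (s_inv z) = 0 /\ s (s_inv z) = z.
Proof.
case/s_onto=> x rkx sx; rewrite /s_inv; case: pickP => [y /andP[/eqP-> /eqP->]|/(_ x)] //=.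
by rewrite rkx sx !eqxx.
Qed.

(* The element of level 2 in the chain of x. *)
Definition hub (x : P) : P :=
  match rk x with 0 => f (p x) | 1 => f x | 2 => x | _ => f (p (s_inv x)) end.

Lemma rk_le3 (x : P) : rk x <= 3.
Proof. by rewrite -rank3; apply: leq_bigmax. Qed.

Lemma f_gt (l : P) : rk l = 1 -> rk (f l) = 2 /\ (l < f l)%O.
Proof.
move=> rkl; have [] := fP (x := l); rewrite ?inE ?rkl // => /eqP rkf cmp.
by split=> //; apply: comparable_rk_lt; rewrite ?rkf ?rkl // comparable_sym.
Qed.

Lemma ps_gt (x : P) : rk x = 0 ->
  [/\ rk (p x) = 1, (x < p x)%O, rk (s x) = 3 & (f (p x) < s x)%O].
Proof.
move=> rkx; have [] := psP (x := x); rewrite ?inE ?rkx // => /eqP rkp cp /eqP rks cs.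
have [rkf _] := f_gt rkp.
by split=> //; apply: comparable_rk_lt; rewrite ?rkx ?rkp ?rkf ?rks // comparable_sym.
Qed.

Lemma hub_compare (x : P) :
  rk (hub x) = 2 /\ (if (rk x <= 2)%N then x <= hub x else hub x <= x)%O.
Proof.
have := rk_le3 x; rewrite /hub; case Erk: (rk x) => [|[|[|[|n]]]] // _ /=.
- have [rkp ltxp _ _] := ps_gt Erk; have [rkf ltpf] := f_gt rkp.
  by split=> //; apply/ltW/(lt_trans ltxp).
- by have [rkf /ltW] := f_gt Erk.
- by split.
- have [rkt st] := s_invP Erk; have [rkp _ _ ltfs] := ps_gt rkt.
  by have [rkf _] := f_gt rkp; split=> //; rewrite -{2}st ltW.
Qed.

Lemma hub_inj (x y : P) : rk x = rk y -> hub x = hub y -> x = y.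
Proof.
have injfp u v : rk u = 0 -> rk v = 0 -> f (p u) = f (p v) -> u = v.
  move=> rku rkv eqf; have [rkpu _ _ _] := ps_gt rku; have [rkpv _ _ _] := ps_gt rkv.
  by apply: injp; rewrite ?inE ?rku ?rkv //; apply: injf; rewrite ?inE ?rkpu ?rkpv.
have := rk_le3 x; rewrite /hub => + eqrk; rewrite -eqrk.
case Erk: (rk x) eqrk => [|[|[|[|n]]]] // /esym rky _ eqf.
- exact: injfp.
- by apply: injf; rewrite ?inE ?Erk ?rky.
- have [rktx sx] := s_invP Erk; have [rkty sy] := s_invP rky.
  by rewrite -sx -sy (injfp (s_inv x) (s_inv y)).
Qed.

(* A chain meeting rank i meets every rank of priority at most that of i. *)
Definition priority (i : nat) : nat := nth 0 [:: 2; 1; 0; 2] i.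

(** The rank sets of the fibres are {2}, {1, 2} and {0, 1, 2, 3}, nested in the order of [priority];
    ranks 0 and 3 tie because [s] pairs them. *)
Lemma hub_priority (x : P) (j : nat) :
  j <= 3 -> priority j <= priority (rk x) -> exists2 y, rk y = j & hub y = hub x.
Proof.
have [rkh _] := hub_compare x.
have hub2 : hub (hub x) = hub x by rewrite {1}/hub rkh.
have hub0 u : rk u = 0 -> hub (s u) = hub u /\ hub (p u) = hub u.
  move=> rku; have [rkp _ rks _] := ps_gt rku.
  rewrite /hub rku rkp rks; split=> //; have [rkt st] := s_invP rks.
  by rewrite (injs _ _ st) // inE ?rkt ?rku.
have := rk_le3 x; case Erk: (rk x) => [|[|[|[|n]]]] // _;
  case: j => [|[|[|[|j]]]] // _ _; try (by exists x); try (by exists (hub x)).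
- by have [rkp _ _ _] := ps_gt Erk; have [_ hp] := hub0 x Erk; exists (p x).
- by have [_ _ rks _] := ps_gt Erk; have [hs _] := hub0 x Erk; exists (s x).
- have [rkt st] := s_invP Erk; exists (s_inv x) => //.
  by have [hs _] := hub0 _ rkt; rewrite -hs st.
- have [rkt st] := s_invP Erk; exists (p (s_inv x)); first by have [] := ps_gt rkt.
  by have [hs ->] := hub0 _ rkt; rewrite -hs st.
Qed.

(** The common hub separates [x] from [y], except at ranks 0 and 1, both below it; there injectivity
    of [f] forces [y] to be [p x]. *)
Lemma hub_comparable (x y : P) : hub x = hub y -> (x >=< y)%O.
Proof.
wlog lexy : x y / rk x <= rk y => [wlg eqh|eqh].
  case: (leqP (rk x) (rk y)) => [|/ltnW] /wlg; first exact.
  by rewrite comparable_sym; apply.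
move: lexy; rewrite leq_eqVlt => /orP[/eqP eqrk|ltxy].
  by rewrite (hub_inj eqrk eqh) comparablexx.
have [_] := hub_compare x; have [_] := hub_compare y; rewrite -eqh.
have := rk_le3 y; case Erky: (rk y) ltxy => [|[|[|[|n]]]] // ltxy _ /=.
- move=> _ _; have rkx : rk x = 0 by case: (rk x) ltxy.
  move: eqh; rewrite /hub rkx Erky => /injf <-; rewrite ?inE ?Erky //;
    have [rkp ltxp _ _] := ps_gt rkx; rewrite ?rkp //; exact: lt_comparable.
- have hy : hub y = y by rewrite /hub Erky.
  by rewrite eqh hy ltnW // => _; apply: le_comparable.
- move=> ley; rewrite -ltnS ltxy => lex; exact/le_comparable/(le_trans lex).
Qed.

Lemma hub_nested : nested P.
Proof.
exists (preim_partition hub [set: P]).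
have blockE A : A \in preim_partition hub [set: P] ->
    exists x, A = [set y | hub x == hub y].
  by case/imsetP=> x _ ->; exists x; apply/setP=> y; rewrite !inE.
split=> [|A B /blockE[x ->] /blockE[y ->]].
  split=> [|A /blockE[x ->]]; first exact: preim_partitionP.
  apply/is_chainP; split=> [|y z]; first by apply/set0Pn; exists x; rewrite inE.
  by rewrite !inE => /eqP hy /eqP hz; apply: hub_comparable; rewrite -hy hz.
(* A fibre meets each rank at most once, so its size is the size of its rank set. *)
pose ranks u : {set 'I_4} := [set inord (rk v) | v in [set v | hub u == hub v]].
have card_ranks u : #|[set v | hub u == hub v]| = #|ranks u|.
  rewrite card_in_imset // => v w; rewrite !inE => /eqP hv /eqP hw /(congr1 val).
  by rewrite /= !inordK ?ltnS ?rk_le3 // => eqrk; apply: hub_inj; rewrite // -hv.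
rewrite !card_ranks => leAB _ /imageP[u + ->]; rewrite inE => /eqP hu.
have [ex|nex] := boolP [exists v, (hub y == hub v) && (rk v == rk u)].
  by have /existsP[v /andP[hv /eqP<-]] := ex; apply: image_f; rewrite inE.
suff : #|ranks y| < #|ranks x| by rewrite ltnNge leAB.
(* If the fibre of [y] misses the rank of [u], all its ranks have smaller priority, so its rank set
   lies strictly inside that of [x]. *)
have lt_prio v : hub y = hub v -> priority (rk v) < priority (rk u).
  move=> hv; rewrite ltnNge; apply: contra nex => /(hub_priority (rk_le3 u))[w rkw hw].
  by apply/existsP; exists w; rewrite hv hw rkw !eqxx.
apply/proper_card/properP; split.
  apply/subsetP=> _ /imsetP[v + ->]; rewrite inE => /eqP /lt_prio/ltnW.
  case/(hub_priority (rk_le3 v))=> w rkw hw.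
  by apply/imsetP; exists w; rewrite ?inE ?rkw // hw hu.
exists (inord (rk u)); first by apply/imsetP; exists u; rewrite ?inE ?hu.
apply/imsetP=> -[v]; rewrite inE => /eqP hv /(congr1 val).
rewrite /= !inordK ?ltnS ?rk_le3 // => eqrk.
by have := lt_prio v hv; rewrite eqrk ltnn.
Qed.

End Nesting.

Theorem theorem2p6 (r0 r1 r2 : nat) (d : Order.disp_t) (P : finPOrderType d)
    (hr0 : 0 < r0) (hr01 : r0 < r1) (hr12 : r1 < r2)
    (hP : in_NM [:: r0; r1; r2; r0] P)
    (hk : exists k : int, (k * r0%:Z <= r1%:Z)%R /\ (r1%:Z <= k * (r0%:Z + 1))%R) :
  nested P.
Proof.
case: hP => grP nmP rnP.
have rank3 : poset_rank P = 3 by have := congr1 size rnP; rewrite size_map size_iota => -[].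
move: rnP; rewrite /rank_numbers rank3 => -[c0 c1 c2 c3].
(* A negative [k] would make the upper bound on [r1] negative. *)
have [k [kr0 r1k]] : exists k : nat, k * r0 <= r1 /\ r1 <= k * r0.+1.
  by case: hk => -[k|k] [le1 le2]; [exists k; lia | nia].
have ratio i j : i <= 3 -> j <= 3 ->
    matching_ratio (fun x y : P => (x >=< y)%O) (level P i) (level P j).
  have lvl0 l : l <= 3 -> 0 < #|level P l|.
    case: l => [|[|[|[|l]]]] // _; rewrite ?c0 ?c1 ?c2 ?c3 //; lia.
  by move=> lei lej; apply: normalized_matching_ratio; rewrite ?rank3 ?lvl0.
(* The upper bound on [r1] says exactly that the remainder [r1 - k * r0] is at most [k]. *)
have [||||f [p [s [fP injf psP injp injs]]]] := disjoint_paths (k := k) (e := r1 - k * r0)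
  (ratio 0 1 isT isT) (ratio 2 1 isT isT) (ratio 3 2 isT isT) (etrans c0 (esym c3)).
- by rewrite c1 c3; lia.
- by rewrite leq_subLR -mulnSr.
- by rewrite c1 c2 ltnW.
- by rewrite c1; lia.
exact: hub_nested grP rank3 f p s fP injf psP injp injs (etrans c0 (esym c3)).
Qed.
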